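(* Let $M$ be a $2\times 2$ matrix over $\{0,1,\ast\}$ with $M_{1,1}=M_{2,2}=0$ and $M\neq M_1=\begin{pmatrix}0&\ast\\ \ast&0\end{pmatrix}$. Then there are only finitely many minimal $M$-obstructions. More precisely, for the matrices $$M_2=\begin{pmatrix}0&0\\ \ast&0\end{pmatrix},\ M_3=\begin{pmatrix}0&1\\ \ast&0\end{pmatrix},\ M_4=\begin{pmatrix}0&0\\ 1&0\end{pmatrix},\ M_5=\begin{pmatrix}0&1\\ 1&0\end{pmatrix},\ M_6=\begin{pmatrix}0&0\\ 0&0\end{pmatrix}$$ the minimal $M_i$-obstructions (up to isomorphism) are exactly the following: (i) for $M_2$: the digon; the directed path $x\to y\to z$ on three vertices with $x,z$ non-adjacent; the transitive tournament on three vertices; the directed $3$-cycle; (ii) for $M_3$: every digraph on three vertices whose underlying graph is the triangle $K_3$; every digraph on three vertices whose underlying graph is $K_1+K_2$ (one edge and an isolated vertex); the directed path $x\to y\to z$ on three vertices with $x,z$ non-adjacent (all arcs asymmetric); and the digraph on vertices $x,y,x',y'$ whose arcs are exactly $(x,y)$, $(y',x')$, $(x,y'),(y',x)$, $(x',y),(y,x')$ (so its underlying graph is the $4$-cycle $x\,y\,x'\,y'$, with two opposite asymmetric arcs $x\to y$, $y'\to x'$ and the other two edges digons); (iii) for $M_4$: the digon; the transitive tournament on three vertices; the directed $3$-cycle; the digraph on three vertices consisting of one asymmetric arc and an isolated vertex; the directed path $x\to y\to z$ with $x,z$ non-adjacent; (iv) for $M_5$: the asymmetric arc (two vertices, exactly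 one arc); the biorientation of $K_3$; the biorientation of $K_1+K_2$; (v) for $M_6$: the asymmetric arc and the digon.
   Context: Digraphs have no loops and no multiple arcs in the same direction. A digon is a pair of vertices joined by arcs in both directions (also the digraph on two vertices with both arcs); an asymmetric arc is an arc $(x,y)$ with $(y,x)$ absent. The underlying graph of a digraph has an edge $xy$ whenever $(x,y)$ or $(y,x)$ is an arc. The biorientation of a graph $G$ replaces each edge by arcs in both directions. $K_1+K_2$ denotes the disjoint union of a vertex and an edge. Given a $2\times2$ matrix $M$ over $\{0,1,\ast\}$, an $M$-partition of a digraph $D$ is a partition of $V_D$ into parts $V_1,V_2$ (possibly empty) such that: for each $i$, two distinct vertices of $V_i$ are non-adjacent if $M_{i,i}=0$, and joined by arcs in both directions if $M_{i,i}=1$; for $i\neq j$, every vertex of $V_i$ has an arc to every vertex of $V_j$ if $M_{i,j}=1$, and no vertex of $V_i$ has an arc to any vertex of $V_j$ if $M_{i,j}=0$; $\ast$ imposes no restriction. A minimal $M$-obstruction is a digraph that admits no $M$-partition but every proper induced subdigraph of which admits one. *)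

(* Defs.v *)
From mathcomp Require Import all_boot all_order all_algebra.

Set Implicit Arguments.
Unset Strict Implicit.
Unset Printing Implicit Defensive.

(** Digraphs and graphs are finite. *)

Record digraph := Digraph {
  dvertex :> finType;
  darc : rel dvertex;
  darc_irr : irreflexive darc
}.

Record sgraph := SGraph {
  svertex :> finType;
  edge : rel svertex;
  edge_sym : symmetric edge;
  edge_irr : irreflexive edge
}.

Definition digraph_iso (D E : digraph) : Prop :=
  exists2 f : D -> E, bijective f & forall u v, darc (f u) (f v) = darc u v.

Definition sgraph_iso (G H : sgraph) : Prop :=
  exists2 f : G -> H, bijective f & forall u v, edge (f u) (f v) = edge u v.

Section Induced.
Variables (D : digraph) (A : {set D}).

Definition induced_arc : rel {x : D | x \in A} :=
  fun u v => darc (val u) (val v).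

Lemma induced_arc_irr : irreflexive induced_arc.
Proof. by move=> u; apply: darc_irr. Qed.

Definition induced : digraph := Digraph induced_arc_irr.
End Induced.

Section Underlying.
Variable D : digraph.

Definition adjacent : rel D := fun u v => darc u v || darc v u.

Lemma adjacent_sym : symmetric adjacent.
Proof. by move=> u v; rewrite /adjacent orbC. Qed.

Lemma adjacent_irr : irreflexive adjacent.
Proof. by move=> u; rewrite /adjacent darc_irr. Qed.

Definition underlying : sgraph := SGraph adjacent_sym adjacent_irr.
End Underlying.

Definition biorientation (G : sgraph) : digraph := Digraph (@edge_irr G).

Section Complete.
Variable n : nat.

Definition complete_edge : rel 'I_n := fun i j => i != j.

Lemma complete_edge_sym : symmetric complete_edge.
Proof. by move=> i j; rewrite /complete_edge eq_sym. Qed.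

Lemma complete_edge_irr : irreflexive complete_edge.
Proof. by move=> i; rewrite /complete_edge eqxx. Qed.

Definition complete_graph : sgraph :=
  SGraph complete_edge_sym complete_edge_irr.
End Complete.

Section DisjointUnion.
Variables G H : sgraph.

Definition disjoint_union_edge : rel (G + H)%type := fun u v =>
  match u, v with
  | inl x, inl y => edge x y
  | inr x, inr y => edge x y
  | _, _ => false
  end.

Lemma disjoint_union_edge_sym : symmetric disjoint_union_edge.
Proof. by move=> [x|x] [y|y] //=; apply: edge_sym. Qed.

Lemma disjoint_union_edge_irr : irreflexive disjoint_union_edge.
Proof. by move=> [x|x] /=; apply: edge_irr. Qed.

Definition disjoint_union : sgraph :=
  SGraph disjoint_union_edge_sym disjoint_union_edge_irr.
End DisjointUnion.

Definition K3 : sgraph := complete_graph 3.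
Definition K1_plus_K2 : sgraph :=
  disjoint_union (complete_graph 1) (complete_graph 2).

Section ListedArcs.
Variables (n : nat) (s : seq (nat * nat)).

Definition listed_arc : rel 'I_n :=
  fun u v => (u != v) && ((val u, val v) \in s).

Lemma listed_arc_irr : irreflexive listed_arc.
Proof. by move=> u; rewrite /listed_arc eqxx. Qed.

(** The digraph on {0, ..., n-1} whose arcs are the pairs in [s]. *)
Definition digraph_of_arcs : digraph := Digraph listed_arc_irr.
End ListedArcs.

Definition asymmetric_arc : digraph := digraph_of_arcs 2 [:: (0, 1)].
Definition digon : digraph := digraph_of_arcs 2 [:: (0, 1); (1, 0)].
Definition directed_path3 : digraph := digraph_of_arcs 3 [:: (0, 1); (1, 2)].
Definition transitive_tournament3 : digraph :=
  digraph_of_arcs 3 [:: (0, 1); (1, 2); (0, 2)].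
Definition directed_cycle3 : digraph :=
  digraph_of_arcs 3 [:: (0, 1); (1, 2); (2, 0)].
Definition arc_plus_isolated : digraph := digraph_of_arcs 3 [:: (0, 1)].

(** Vertices x, y, x', y' are numbered 0, 1, 2, 3. *)
Definition mixed_cycle4 : digraph :=
  digraph_of_arcs 4 [:: (0, 1); (3, 2); (0, 3); (3, 0); (2, 1); (1, 2)].

Inductive entry := Zero | One | Star.

(** Indices are shifted by one: the entry in the first row and second column
    is [M 0 1], with 0 and 1 in ['I_2]. *)
Definition mx2 (a b c d : entry) : 'M[entry]_2 :=
  (\matrix_(i < 2, j < 2)
     if i == ord0 then (if j == ord0 then a else b)
     else (if j == ord0 then c else d))%R.

Definition M1 := mx2 Zero Star Star Zero.
Definition M2 := mx2 Zero Zero Star Zero.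
Definition M3 := mx2 Zero One  Star Zero.
Definition M4 := mx2 Zero Zero One  Zero.
Definition M5 := mx2 Zero One  One  Zero.
Definition M6 := mx2 Zero Zero Zero Zero.

(** A partition of the vertices into two possibly empty parts is encoded by
    the function [p] sending a vertex to the index of its part. *)
Definition is_M_partition (M : 'M[entry]_2) (D : digraph) (p : D -> 'I_2) :
    Prop :=
  (forall (i : 'I_2) (u v : D), p u = i -> p v = i -> u != v ->
     match M i i with
     | Zero => ~~ adjacent u v
     | One => darc u v && darc v u
     | Star => true
     end) /\
  (forall (i j : 'I_2) (u v : D), i != j -> p u = i -> p v = j ->
     match M i j with
     | Zero => ~~ darc u v
     | One => darc u v
     | Star => true
     end).

Definition admits_M_partition (M : 'M[entry]_2) (D : digraph) : Prop :=
  exists p : D -> 'I_2, is_M_partition M p.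

Definition minimal_obstruction (M : 'M[entry]_2) (D : digraph) : Prop :=
  ~ admits_M_partition M D /\
  (forall A : {set D}, A \proper [set: D] -> admits_M_partition M (induced A)).

Definition finitely_many_minimal_obstructions (M : 'M[entry]_2) : Prop :=
  exists (n : nat) (H : 'I_n -> digraph),
    forall D : digraph, minimal_obstruction M D ->
      exists i : 'I_n, digraph_iso D (H i).

(* Main.v *)
(** An uncolourable pattern occurring in a minimal obstruction must exhaust it,
    so for each matrix it suffices to find one listed pattern in every digraph
    without partition.
    A digraph has an M2-partition iff no vertex has both an in-neighbour and an
    out-neighbour, and a failure is a walk x -> y -> z.
    For M3, M4 and M5, either three vertices span an odd number of adjacent
    pairs (1 or 3), or adjacency is complete bipartite, split by the
    neighbourhood of any vertex; then only the directions can fail, and two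
    asymmetric arcs crossing in opposite directions yield a directed path or
    the mixed 4-cycle.
    The listed patterns have at most 4 vertices, and exchanging the two parts
    covers the remaining matrices, whence the finiteness. *)

Require Import Defs.
From mathcomp Require Import all_boot all_order all_algebra.

Set Implicit Arguments.
Unset Strict Implicit.
Unset Printing Implicit Defensive.

(** * Isomorphism of binary relations *)

(** Both [digraph_iso] and [sgraph_iso] unfold to instances, with [darc] or [edge] as the relation,
    so digraphs, graphs and tables of arcs are compared uniformly. *)
Definition rel_iso (T U : Type) (r : rel T) (s : rel U) : Prop :=
  exists2 f : T -> U, bijective f & forall u v, s (f u) (f v) = r u v.

Lemma rel_iso_sym (T U : Type) (r : rel T) (s : rel U) :
  rel_iso r s -> rel_iso s r.
Proof.
case=> f [g fK gK] fr; exists g; first by exists f.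
by move=> u v; rewrite -fr !gK.
Qed.

Lemma rel_iso_trans (T U V : Type) (r : rel T) (s : rel U) (t : rel V) :
  rel_iso r s -> rel_iso s t -> rel_iso r t.
Proof.
case=> f fb fr [g gb gs]; exists (g \o f); first exact: bij_comp.
by move=> u v; rewrite /= gs fr.
Qed.

Lemma rel_iso_card (T U : finType) (r : rel T) (s : rel U) :
  rel_iso r s -> #|T| = #|U|.
Proof. by case=> f /bij_eq_card. Qed.

(** * Partitions as two-colourings, and minimality by vertex deletion *)

Definition entry_ok (m : entry) (a : bool) : bool :=
  match m with Zero => ~~ a | One => a | Star => true end.

(** In a colouring, [true] stands for the second part; [color_ok b c x y a] is
    the constraint put by [mx2 Zero b c Zero] on the presence [a] of an arc from
    colour [x] to colour [y]. *)
Definition color_ok (b c : entry) (x y a : bool) : bool :=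
  if x == y then ~~ a else entry_ok (if y then b else c) a.

Definition colorable (b c : entry) (T : Type) (r : rel T) : Prop :=
  exists q : T -> bool, forall u v, color_ok b c (q u) (q v) (r u v).

Lemma colorable_preim (b c : entry) (T U : Type) (r : rel T) (s : rel U)
    (f : T -> U) :
  (forall u v, s (f u) (f v) = r u v) -> colorable b c s -> colorable b c r.
Proof. by move=> fr [q qP]; exists (q \o f) => u v; rewrite /= -fr. Qed.

(** Complementing the colouring exchanges the two parts, hence the two off-diagonal entries. *)
Lemma colorable_swap (b c : entry) (T : Type) (r : rel T) :
  colorable b c r -> colorable c b r.
Proof.
case=> q qP; exists (fun v => ~~ q v) => u v; move: (qP u v).
by rewrite /color_ok; case: (q u); case: (q v).
Qed.

Lemma admitsP (b c : entry) (D : digraph) :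
  admits_M_partition (mx2 Zero b c Zero) D <-> colorable b c (@darc D).
Proof.
split=> [[p [pd po]]|[q qP]].
- exists (fun v => p v != ord0) => u v.
  have ord1 (i : 'I_2) : i != ord0 -> i = ord_max.
    by move=> i0; apply: val_inj; case: i i0 => [[|[|?]] ?].
  (* A partition constrains only distinct vertices on the diagonal; for [u = v] irreflexivity
     supplies the missing case. *)
  have same (i : 'I_2) : p u = i -> p v = i -> ~~ darc u v.
    move=> pu pv; have [->|uv] := eqVneq u v; first by rewrite darc_irr.
    have := pd i u v pu pv uv.
    have -> : mx2 Zero b c Zero i i = Zero by rewrite mxE; case: (i == ord0).
    by rewrite negb_or => /andP[].
  rewrite /color_ok.
  have [pu|/ord1 pu] := eqVneq (p u) ord0; have [pv|/ord1 pv] := eqVneq (p v) ord0.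
  + exact: same pu pv.
  + by have := po ord0 ord_max u v isT pu pv; rewrite mxE /=; case: (b).
  + by have := po ord_max ord0 u v isT pu pv; rewrite mxE /=; case: (c).
  + exact: same pu pv.
- exists (fun v => if q v then ord_max else ord0); split.
  + move=> i u v pu pv _.
    have -> : mx2 Zero b c Zero i i = Zero by rewrite mxE; case: (i == ord0).
    have quv : q u = q v by move: pv; rewrite -pu; case: (q u); case: (q v).
    rewrite negb_or; move: (qP u v) (qP v u).
    by rewrite /color_ok quv eqxx => -> ->.
  + move=> i j u v ij pu pv; move: ij; rewrite -pu -pv mxE; move: (qP u v).
    by rewrite /color_ok; case: (q u); case: (q v) => //=; case: (b); case: (c).
Qed.

(** Colourings restrict to induced subdigraphs, so deleting single vertices is enough. Keeping [q]
    total on [D], constrained only away from [v], avoids subtypes later on. *)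
Lemma minimal_obstructionP (b c : entry) (D : digraph) :
  minimal_obstruction (mx2 Zero b c Zero) D <->
  ~ colorable b c (@darc D) /\
  forall v : D, exists q : D -> bool, forall u w, u != v -> w != v ->
    color_ok b c (q u) (q w) (darc u w).
Proof.
split=> -[nc prop]; split.
- by move/admitsP.
- move=> v; have /prop/admitsP[q qP] : [set~ v] \proper [set: D].
    by rewrite properT; apply/eqP => /setP/(_ v); rewrite !inE eqxx.
  (* The value [false] is taken only at [v] and is never tested. *)
  exists (fun u => if insub u is Some x then q x else false) => u w uv wv.
  have uA : u \in [set~ v] by rewrite !inE.
  have wA : w \in [set~ v] by rewrite !inE.
  by rewrite !insubT; apply: (qP (Sub u uA) (Sub w wA)).
- by move/admitsP.
- move=> A /properP[_ [v _ vA]]; apply/admitsP.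
  have [q qP] := prop v; exists (fun u => q (val u)) => u w.
  by apply: qP; apply: contraNneq vA => <-; apply: valP.
Qed.

Lemma minimal_obstruction_swap (b c : entry) (D : digraph) :
  minimal_obstruction (mx2 Zero b c Zero) D ->
  minimal_obstruction (mx2 Zero c b Zero) D.
Proof.
case=> nc prop; split.
  by move=> /admitsP/colorable_swap/admitsP.
by move=> A /prop/admitsP/colorable_swap/admitsP.
Qed.

(** If [f] missed a vertex, the colouring of [D] without that vertex would pull back along [f] to a
    colouring of [s]. *)
Lemma minimal_bij (b c : entry) (D : digraph) (T : finType)
    (s : rel T) (f : T -> D) :
  minimal_obstruction (mx2 Zero b c Zero) D -> ~ colorable b c s ->
  injective f -> (forall u v, darc (f u) (f v) = s u v) -> bijective f.
Proof.
move=> /minimal_obstructionP[_ prop] nc f_inj fs.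
have f_surj v : v \in codom f.
  apply/negPn/negP => vf; apply: nc; have [q qP] := prop v.
  exists (q \o f) => u w; rewrite -fs.
  by apply: qP; apply: contraNneq vf => <-; apply: codom_f.
apply: inj_card_bij => //; rewrite -(card_codom f_inj).
by apply/subset_leq_card/subsetP => v _; apply: f_surj.
Qed.

(** * Brute-force tests for small digraphs *)

(** Arcs are given on natural numbers so that the tests below reduce by computation; ordinals appear
    only in the types. *)
Definition table (n : nat) (e : rel nat) : rel 'I_n := fun i j => e i j.

Fixpoint bitseqs (n : nat) : seq bitseq :=
  if n is m.+1 then map (cons true) (bitseqs m) ++ map (cons false) (bitseqs m)
  else [:: [::]].

Lemma mem_bitseqs (s : bitseq) : s \in bitseqs (size s).
Proof.
by elim: s => [|[] s IHs] //=; rewrite mem_cat map_f ?orbT.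
Qed.

Section Test.
Variables (b c : entry) (n : nat) (e : rel nat).

(** [P] selects the vertices on which the colouring [s] is checked: all of them for [obstructs], all
    but one for [critical]. *)
Definition valid (P : pred nat) (s : bitseq) : bool :=
  all (fun i => all (fun j => P i ==> P j ==>
    color_ok b c (nth false s i) (nth false s j) (e i j)) (iota 0 n)) (iota 0 n).

Definition obstructs : bool := all (fun s => ~~ valid predT s) (bitseqs n).

Definition critical : bool :=
  all (fun k => has (valid (predC1 k)) (bitseqs n)) (iota 0 n).

Lemma obstructsP : obstructs -> ~ colorable b c (table (n := n) e).
Proof.
move=> /allP ob [q qP].
pose s := map q (enum 'I_n).
have ss : size s = n by rewrite size_map size_enum_ord.
have /ob/negP[] : s \in bitseqs n by rewrite -[in bitseqs _]ss mem_bitseqs.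
have sE (i : 'I_n) : nth false s i = q i.
  by rewrite (nth_map i) ?size_enum_ord // nth_ord_enum.
apply/allP => i; rewrite mem_iota => /andP[_ i_n].
apply/allP => j; rewrite mem_iota => /andP[_ j_n] /=.
by rewrite (sE (Ordinal i_n)) (sE (Ordinal j_n)); apply: qP.
Qed.

Lemma minimal_of_test (D : digraph) :
  rel_iso (@darc D) (table (n := n) e) -> obstructs -> critical ->
  minimal_obstruction (mx2 Zero b c Zero) D.
Proof.
move=> De ob /allP cr; apply/minimal_obstructionP; split.
  have [f _ fr] := rel_iso_sym De.
  by move/(colorable_preim fr); apply: obstructsP.
have [g gb gr] := De => v.
have /cr/hasP[s _ /allP sP] : val (g v) \in iota 0 n by rewrite mem_iota /=.
exists (fun u => nth false s (g u)) => u w uv wv.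
have gi (z : D) : val (g z) \in iota 0 n by rewrite mem_iota /=.
have gv (z : D) : z != v -> predC1 (val (g v)) (val (g z)).
  by rewrite /= val_eqE (bij_eq gb).
have /allP/(_ _ (gi w)) := sP _ (gi u).
by rewrite gv // gv // /= -gr.
Qed.
End Test.

(** * From a pattern inside a minimal obstruction to an isomorphism *)

Lemma all_ord (n : nat) (p : rel nat) :
  all (fun i => all (p i) (iota 0 n)) (iota 0 n) -> forall i j : 'I_n, p i j.
Proof.
have mem (k : 'I_n) : val k \in iota 0 n by rewrite mem_iota /=.
by move=> /allP np i j; have /allP/(_ _ (mem j)) := np _ (mem i).
Qed.

(** The obstruction is tested on the actual arcs among [t], while [r] may be coarser data. This
    serves the families where only adjacency is prescribed. *)
Lemma minimal_rel_iso (b c : entry) (D : digraph) (x : D) (t : seq D)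
    (r : rel D) (e : rel nat) :
  minimal_obstruction (mx2 Zero b c Zero) D -> uniq t ->
  obstructs b c (size t) (fun i j => darc (nth x t i) (nth x t j)) ->
  all (fun i => all (fun j => r (nth x t i) (nth x t j) == e i j)
    (iota 0 (size t))) (iota 0 (size t)) ->
  rel_iso r (table (n := size t) e).
Proof.
move=> Dmin t_uniq ob /all_ord re; apply: rel_iso_sym.
exists (fun i : 'I_(size t) => nth x t i).
  apply: (minimal_bij Dmin (obstructsP ob)) => // i j /eqP.
  by rewrite nth_uniq // => /eqP/val_inj.
by move=> i j; apply/eqP/re.
Qed.

Lemma minimal_embedding (b c : entry) (D : digraph) (x : D) (t : seq D)
    (e : rel nat) :
  minimal_obstruction (mx2 Zero b c Zero) D -> uniq t ->
  obstructs b c (size t) e ->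
  all (fun i => all (fun j => darc (nth x t i) (nth x t j) == e i j)
    (iota 0 (size t))) (iota 0 (size t)) ->
  rel_iso (@darc D) (table (n := size t) e).
Proof.
move=> Dmin t_uniq ob /all_ord te; apply: rel_iso_sym.
exists (fun i : 'I_(size t) => nth x t i).
  apply: (minimal_bij Dmin (obstructsP ob)) => [i j /eqP|i j].
    by rewrite nth_uniq // => /eqP/val_inj.
  exact/eqP/te.
by move=> i j; apply/eqP/te.
Qed.

Definition arcs_of (s : seq (nat * nat)) : rel nat :=
  fun i j => (i != j) && ((i, j) \in s).

Lemma minimal_of_arcs (b c : entry) (n : nat) (s : seq (nat * nat))
    (D : digraph) :
  digraph_iso D (digraph_of_arcs n s) -> obstructs b c n (arcs_of s) ->
  critical b c n (arcs_of s) -> minimal_obstruction (mx2 Zero b c Zero) D.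
Proof. exact: minimal_of_test. Qed.

(** * Three vertices with an odd number of adjacent pairs *)

Definition triangle : rel nat := fun i j => i != j.
(** The isolated vertex is 0, matching the vertex listed first in the triples produced by
    [odd_triple_or_cut]. *)
Definition lone_edge : rel nat := arcs_of [:: (1, 2); (2, 1)].

Lemma K3_iso : rel_iso (@edge K3) (table (n := 3) triangle).
Proof. by exists id => //; exists id. Qed.

Lemma K1_plus_K2_iso : rel_iso (@edge K1_plus_K2) (table (n := 3) lone_edge).
Proof.
exists (@unsplit 1 2); first by exists (@split 1 2); [apply: unsplitK|apply: splitK].
by case=> [[[|i] hi]|[[|[|i]] hi]]; case=> [[[|j] hj]|[[|[|j]] hj]].
Qed.

Lemma rel_iso_eqr (T U V : Type) (r : rel T) (s : rel U) (t : rel V) :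
  rel_iso s t -> rel_iso r s <-> rel_iso r t.
Proof.
move=> st; split=> rs; first exact: rel_iso_trans rs st.
exact: rel_iso_trans rs (rel_iso_sym st).
Qed.

(** The second alternative says that adjacency is complete bipartite between the
    neighbours and the non-neighbours of any vertex [x]. *)
Lemma odd_triple_or_cut (D : digraph) :
  (exists (a : bool) (x y z : D), [/\ uniq [:: x; y; z], adjacent x y = a,
     adjacent x z = a & adjacent y z]) \/
  (forall x u v : D, adjacent u v = adjacent x u (+) adjacent x v).
Proof.
have [/existsP[x /existsP[y /existsP[z /andP[xyz odd]]]]|no] := boolP
  [exists x : D, exists y : D, exists z : D, uniq [:: x; y; z] &&
    (adjacent y z (+) (adjacent x y (+) adjacent x z))].
  (* With a single adjacent pair, the triple is reordered to start with its isolated vertex. *)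
  left; move: odd; case Exy: (adjacent x y); case Exz: (adjacent x z);
    case Eyz: (adjacent y z) => //= _.
  - by exists true, x, y, z.
  - exists false, z, x, y; split=> //; try by rewrite adjacent_sym.
    move: xyz; rewrite /= !inE !negb_or (eq_sym z) (eq_sym z) !andbT.
    by move=> /andP[/andP[-> ->] ->].
  - exists false, y, x, z; split=> //; try by rewrite adjacent_sym.
    move: xyz; rewrite /= !inE !negb_or (eq_sym y x) !andbT.
    by move=> /andP[/andP[-> ->] ->].
  - by exists false, x, y, z.
right=> x u v; have [->|xu] := eqVneq x u; first by rewrite adjacent_irr.
have [->|xv] := eqVneq x v; first by rewrite adjacent_irr addbF adjacent_sym.
have [->|uv] := eqVneq u v; first by rewrite adjacent_irr addbb.
move: no; rewrite negb_exists => /forallP/(_ x).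
rewrite negb_exists => /forallP/(_ u); rewrite negb_exists => /forallP/(_ v).
rewrite /= !inE !negb_or xu xv uv /=.
by case: (adjacent u v); case: (adjacent x u); case: (adjacent x v).
Qed.


(** Under [One] and [Star] adjacency is complete bipartite, so every triple of a colourable digraph
    has evenly many adjacent pairs; any two vertices alone are colourable. All directions are
    checked by cases. *)
Lemma odd_triple_test (r : rel nat) (a : bool) :
  r 0 0 = false -> r 1 1 = false -> r 2 2 = false ->
  r 0 1 || r 1 0 = a -> r 0 2 || r 2 0 = a -> r 1 2 || r 2 1 ->
  obstructs One Star 3 r && critical One Star 3 r.
Proof.
rewrite /obstructs /critical /valid /= => -> -> ->.
by case: a; case: (r 0 1); case: (r 1 0); case: (r 0 2); case: (r 2 0);
  case: (r 1 2); case: (r 2 1).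
Qed.

Lemma minimal_of_odd_triple (D : digraph) (a : bool) :
  rel_iso (@adjacent D) (table (n := 3) (if a then triangle else lone_edge)) ->
  minimal_obstruction M3 D.
Proof.
case=> g [f gK fK] gr.
(* [inord] turns the transported arcs into a relation on natural numbers; only indices below 3
   matter. *)
pose e i j := darc (f (inord i)) (f (inord j)).
have De : rel_iso (@darc D) (table (n := 3) e).
  by exists g; [exists f | move=> u v; rewrite /table /e !inord_val !gK].
have adj i j : i < 3 -> j < 3 ->
    e i j || e j i = (if a then triangle else lone_edge) i j.
  by move=> i3 j3; rewrite -[_ || _]/(adjacent _ _) -gr !fK /table !inordK.
have /andP[] : obstructs One Star 3 e && critical One Star 3 e.
  by apply: (@odd_triple_test e a); rewrite ?adj //;
    first [exact: darc_irr | case: (a)].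
exact: minimal_of_test De.
Qed.

(** * Recognising the listed patterns *)

Lemma darc_neq (D : digraph) (x y : D) : darc x y -> x != y.
Proof. by apply: contraTneq => ->; rewrite darc_irr. Qed.

Lemma asym_neq (D : digraph) (x y z : D) :
  darc x y -> ~~ darc z y -> x != z.
Proof. by move=> xy; apply: contraNneq => <-. Qed.

Definition path_arcs := arcs_of [:: (0, 1); (1, 2)].
Definition transitive_arcs := arcs_of [:: (0, 1); (1, 2); (0, 2)].
Definition cycle_arcs := arcs_of [:: (0, 1); (1, 2); (2, 0)].

Lemma minimal_digon (b c : entry) (D : digraph) (x y : D) :
  minimal_obstruction (mx2 Zero b c Zero) D ->
  obstructs b c 2 (arcs_of [:: (0, 1); (1, 0)]) ->
  darc x y -> darc y x -> digraph_iso D digon.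
Proof.
move=> Dmin ob xy yx; have t_uniq : uniq [:: x; y] by rewrite /= inE (darc_neq xy).
apply: (minimal_embedding (x := x) Dmin t_uniq ob) => /=.
by rewrite !darc_irr xy yx.
Qed.

Lemma minimal_asymmetric_arc (b c : entry) (D : digraph) (x y : D) :
  minimal_obstruction (mx2 Zero b c Zero) D ->
  obstructs b c 2 (arcs_of [:: (0, 1)]) ->
  darc x y -> ~~ darc y x -> digraph_iso D asymmetric_arc.
Proof.
move=> Dmin ob xy yx; have t_uniq : uniq [:: x; y] by rewrite /= inE (darc_neq xy).
apply: (minimal_embedding (x := x) Dmin t_uniq ob) => /=.
by rewrite !darc_irr xy (negPf yx).
Qed.

Lemma minimal_path (b c : entry) (D : digraph) (x y z : D) :
  minimal_obstruction (mx2 Zero b c Zero) D -> obstructs b c 3 path_arcs ->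
  darc x y -> ~~ darc y x -> darc y z -> ~~ darc z y -> ~~ adjacent x z ->
  digraph_iso D directed_path3.
Proof.
move=> Dmin ob xy yx yz zy; rewrite negb_or => /andP[xz zx].
have t_uniq : uniq [:: x; y; z].
  by rewrite /= !inE negb_or (darc_neq xy) (darc_neq yz) (asym_neq xy zy).
apply: (minimal_embedding (x := x) Dmin t_uniq ob) => /=.
by rewrite !darc_irr xy yz (negPf yx) (negPf zy) (negPf xz) (negPf zx).
Qed.

(** Without digons, only the pair [x], [z] is undetermined, and its three possible states give the
    three patterns. The ends differ, since [x = z] would make a digon. *)
Lemma minimal_oriented_walk (b c : entry) (D : digraph) (x y z : D) :
  minimal_obstruction (mx2 Zero b c Zero) D ->
  obstructs b c 3 path_arcs -> obstructs b c 3 transitive_arcs ->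
  obstructs b c 3 cycle_arcs ->
  (forall u v : D, darc u v -> ~~ darc v u) -> darc x y -> darc y z ->
  digraph_iso D directed_path3 \/ digraph_iso D transitive_tournament3 \/
  digraph_iso D directed_cycle3.
Proof.
move=> Dmin obp obt obc asym xy yz.
have yx := asym _ _ xy; have zy := asym _ _ yz.
have t_uniq : uniq [:: x; y; z].
  by rewrite /= !inE negb_or (darc_neq xy) (darc_neq yz) (asym_neq xy zy).
have [xz|xz] := boolP (darc x z).
  right; left; apply: (minimal_embedding (x := x) Dmin t_uniq obt) => /=.
  by rewrite !darc_irr xy yz xz (negPf yx) (negPf zy) (negPf (asym _ _ xz)).
have [zx|zx] := boolP (darc z x).
  right; right; apply: (minimal_embedding (x := x) Dmin t_uniq obc) => /=.
  by rewrite !darc_irr xy yz zx (negPf yx) (negPf zy) (negPf xz).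
left; apply: minimal_path Dmin obp xy yx yz zy _.
by rewrite negb_or xz.
Qed.

(** * Dichotomies on arcs, and arcs crossing a cut *)

Lemma asymmetricP (D : digraph) :
  (exists x y : D, darc x y /\ ~~ darc y x) \/ @adjacent D =2 @darc D.
Proof.
have [/existsP[x /existsP[y /andP[xy yx]]]|no] := boolP
    [exists x : D, exists y : D, darc x y && ~~ darc y x].
  by left; exists x, y.
right=> x y; rewrite /adjacent; apply/orb_idr => yx; apply: contraNT no => xy.
by apply/existsP; exists y; apply/existsP; exists x; rewrite yx.
Qed.

Lemma orientedP (D : digraph) :
  (exists x y : D, darc x y /\ darc y x) \/
  (forall x y : D, darc x y -> ~~ darc y x).
Proof.
have [/existsP[x /existsP[y /andP[xy yx]]]|no] := boolP
    [exists x : D, exists y : D, darc x y && darc y x].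
  by left; exists x, y.
right=> x y xy; apply: contra no => yx.
by apply/existsP; exists x; apply/existsP; exists y; rewrite xy.
Qed.

Lemma uncolorable_arc (b c : entry) (D : digraph) :
  ~ colorable b c (@darc D) -> exists x y : D, darc x y.
Proof.
move=> nc; have [/existsP[x /existsP[y xy]]|no] := boolP
    [exists x : D, exists y : D, darc x y]; first by exists x, y.
(* Without arcs, putting all vertices into one part is a colouring. *)
case: nc; exists xpred0 => u v; apply: contra no => uv.
by apply/existsP; exists u; apply/existsP; exists v.
Qed.

(** [x] and [u] lie on one side of the cut, [y] and [v] on the other. *)
Lemma opposite_arcs (D : digraph) (q : D -> bool) (x y u v : D) :
  (forall s t, adjacent s t = q s (+) q t) ->
  darc x y -> ~~ darc y x -> darc v u -> ~~ darc u v -> q u = q x ->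
  (exists p1 p2 p3 : D, [/\ darc p1 p2, ~~ darc p2 p1, darc p2 p3,
     ~~ darc p3 p2 & ~~ adjacent p1 p3]) \/
  [/\ darc x v, darc v x, darc u y & darc y u].
Proof.
move=> cut xy yx vu uv qux.
have qyx : q y = ~~ q x.
  by have := cut x y; rewrite /adjacent xy; case: (q x); case: (q y).
have qvx : q v = ~~ q x.
  by have := cut v u; rewrite /adjacent vu qux; case: (q x); case: (q v).
have nxu : ~~ adjacent x u by rewrite cut qux addbb.
have nux : ~~ adjacent u x by rewrite cut qux addbb.
have nyv : ~~ adjacent y v by rewrite cut qyx qvx addbb.
have nvy : ~~ adjacent v y by rewrite cut qyx qvx addbb.
have := cut x v; rewrite qvx addbN addbb /adjacent.
have := cut u y; rewrite qyx qux addbN addbb /adjacent.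
have [xv|xv] := boolP (darc x v); have [vx|vx] := boolP (darc v x);
  have [uy|uy] := boolP (darc u y); have [yu|yu] := boolP (darc y u) => //= _ _.
all: try by right.
all: left.
(* An asymmetric arc between [x] and [v], or between [u] and [y], extends one of the two given arcs
   to a directed path whose ends lie on the same side. *)
all: solve [ by exists x, v, u | by exists v, x, y | by exists v, u, y
           | by exists x, y, u ].
Qed.

(** * Minimal obstructions of the five matrices *)

Section Classification.
Variable D : digraph.

Lemma M2_obstructions : minimal_obstruction M2 D <->
  (digraph_iso D digon \/ digraph_iso D directed_path3 \/
   digraph_iso D transitive_tournament3 \/ digraph_iso D directed_cycle3).
Proof.
split=> [Dmin|]; last first.
  by case=> [|[|[|]]] DH; apply: (minimal_of_arcs DH).
have [[x [y [xy yx]]]|asym] := orientedP D.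
  by left; apply: (minimal_digon Dmin _ xy yx).
right; have /minimal_obstructionP[nc _] := Dmin.
have [/existsP[x /existsP[y /existsP[z /andP[xy yz]]]]|no] := boolP
    [exists x : D, exists y : D, exists z : D, darc x y && darc y z].
  exact: minimal_oriented_walk Dmin _ _ _ asym xy yz.
(* Arcs may only go from the second part to the first, so the vertices with an out-neighbour form
   the second part. *)
case: nc; exists (fun u => [exists v, darc u v]) => u v; rewrite /color_ok.
have walk (s t w : D) : darc s t -> ~~ darc t w.
  move=> st; apply: contra no => tw; apply/existsP; exists s.
  by apply/existsP; exists t; apply/existsP; exists w; rewrite st.
have [uv|uv] := boolP (darc u v); last by case: eqP => // _; case: ifP.
have -> : [exists w, darc u w] by apply/existsP; exists v.
suff /negPf-> : ~~ [exists w, darc v w] by [].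
by rewrite negb_exists; apply/forallP => w; apply: walk uv.
Qed.

Lemma M3_obstructions : minimal_obstruction M3 D <->
  (sgraph_iso (underlying D) K3 \/ sgraph_iso (underlying D) K1_plus_K2 \/
   digraph_iso D directed_path3 \/ digraph_iso D mixed_cycle4).
Proof.
have K3E := rel_iso_eqr (@adjacent D) K3_iso.
have K12E := rel_iso_eqr (@adjacent D) K1_plus_K2_iso.
split=> [Dmin|]; last first.
  case=> [/K3E DH|[/K12E DH|[DH|DH]]].
  - exact: (minimal_of_odd_triple (a := true)).
  - exact: (minimal_of_odd_triple (a := false)).
  - by apply: (minimal_of_arcs DH).
  - by apply: (minimal_of_arcs DH).
have /minimal_obstructionP[nc _] := Dmin.
have [[a [x [y [z [t_uniq xy xz yz]]]]]|cut] := odd_triple_or_cut D.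
  have /andP[ob _] := @odd_triple_test (fun i j =>
    darc (nth x [:: x; y; z] i) (nth x [:: x; y; z] j)) a
    (darc_irr x) (darc_irr y) (darc_irr z) xy xz yz.
  case: a xy xz => xy xz; [left; apply/K3E|right; left; apply/K12E];
    apply: (minimal_rel_iso Dmin t_uniq ob) => /=;
    by rewrite !adjacent_irr !(adjacent_sym y) !(adjacent_sym z) xy xz yz.
have [[x [y [xy yx]]]|adjE] := asymmetricP D; last first.
  have [x _] := uncolorable_arc nc.
  case: nc; exists (adjacent x) => u v; rewrite -adjE (cut x u v) /color_ok.
  by case: (adjacent x u); case: (adjacent x v).
(* The arc from [x] to [y] makes the side of [x] the first part. Colouring by the neighbourhood of
   [x] fails only if some [u] on that side has no arc to some [v] opposite; then [v] has an
   asymmetric arc to [u]. *)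
have [/existsP[u /existsP[v /and3P[xu xv uv]]]|no] := boolP [exists u, exists v,
    [&& ~~ adjacent x u, adjacent x v & ~~ darc u v]]; last first.
  case: nc; exists (adjacent x) => u v; rewrite /color_ok.
  have := cut x u v; case xu: (adjacent x u); case xv: (adjacent x v) => //=.
  + by move=> /negbT; rewrite negb_or => /andP[].
  + move=> _; apply: contraNT no => uv.
    by apply/existsP; exists u; apply/existsP; exists v; rewrite xu xv.
  + by move=> /negbT; rewrite negb_or => /andP[].
have vu : darc v u.
  by have := cut x u v; rewrite (negPf xu) xv /adjacent (negPf uv).
have qux : adjacent x u = adjacent x x by rewrite (negPf xu) adjacent_irr.
right; right.
have [[p1 [p2 [p3 [p12 p21 p23 p32 p13]]]]|[xv' vx uy yu]] :=
    opposite_arcs (cut x) xy yx vu uv qux.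
  by left; apply: minimal_path Dmin _ p12 p21 p23 p32 p13.
(* Here [u] and [v] play x' and y' of the mixed 4-cycle. *)
right; have t_uniq : uniq [:: x; y; u; v].
  rewrite /= !inE !negb_or (darc_neq xy) (darc_neq xv') (darc_neq yu).
  by rewrite (asym_neq xv' uv) (eq_sym y) (asym_neq vx yx) eq_sym (darc_neq vu).
have ob : obstructs One Star 4 (arcs_of
    [:: (0, 1); (3, 2); (0, 3); (3, 0); (2, 1); (1, 2)]) by [].
apply: (minimal_embedding (x := x) Dmin t_uniq ob) => /=.
have /norP[yv vy] : ~~ adjacent y v by rewrite (cut x) xv /adjacent xy.
have /norP[nxu nux] := xu.
by rewrite !darc_irr xy xv' vx uy yu vu !(negPf yx, negPf uv, negPf yv, negPf vy,
  negPf nxu, negPf nux).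
Qed.

Lemma M4_obstructions : minimal_obstruction M4 D <->
  (digraph_iso D digon \/ digraph_iso D transitive_tournament3 \/
   digraph_iso D directed_cycle3 \/ digraph_iso D arc_plus_isolated \/
   digraph_iso D directed_path3).
Proof.
split=> [Dmin|]; last first.
  by case=> [|[|[|[|]]]] DH; apply: (minimal_of_arcs DH).
have [[x [y [xy yx]]]|asym] := orientedP D.
  by left; apply: (minimal_digon Dmin _ xy yx).
right; have /minimal_obstructionP[nc _] := Dmin.
have walk (x y z : D) : darc x y -> darc y z ->
    digraph_iso D transitive_tournament3 \/ digraph_iso D directed_cycle3 \/
    digraph_iso D arc_plus_isolated \/ digraph_iso D directed_path3.
  move=> xy yz.
  by have [|[|]] := minimal_oriented_walk Dmin isT isT isT asym xy yz; auto.
have [[[] [x [y [z [t_uniq xy xz yz]]]]]|cut] := odd_triple_or_cut D.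
(* Every orientation of a triangle contains a walk of two arcs. *)
- move: xy xz yz => /orP[xy|yx] /orP[xz|zx] /orP[yz|zy].
  + exact: walk xy yz.
  + exact: walk xz zy.
  + exact: walk xy yz.
  + exact: walk zx xy.
  + exact: walk yx xz.
  + exact: walk yx xz.
  + exact: walk yz zx.
  + exact: walk zy yx.
- right; right; left.
  have arc (u v : D) : darc u v -> ~~ adjacent x u -> ~~ adjacent x v ->
      uniq [:: u; v; x] -> digraph_iso D arc_plus_isolated.
    move=> uv; rewrite !negb_or => /andP[xu ux] /andP[xv vx] uvx.
    have ob : obstructs Zero One 3 (arcs_of [:: (0, 1)]) by [].
    apply: (minimal_embedding (x := x) Dmin uvx ob) => /=.
    by rewrite !darc_irr uv (negPf (asym _ _ uv)) (negPf xu) (negPf ux)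
      (negPf xv) (negPf vx).
  move: t_uniq; rewrite /= !inE !negb_or => /and3P[/andP[nxy nxz] nyz _].
  case/orP: yz => [yz|zy]; [apply: arc yz _ _ _|apply: arc zy _ _ _];
    rewrite ?xy ?xz //= !inE !negb_or.
  + by rewrite nyz !(eq_sym _ x) nxy nxz.
  + by rewrite (eq_sym z) nyz !(eq_sym _ x) nxy nxz.
(* All arcs must go from the second part to the first, so the base vertex [x] is chosen as the head
   of an arc. A failure is an arc leaving the side of [x]. *)
have [y [x yx]] := uncolorable_arc nc.
have [/existsP[u /existsP[v /and3P[xu xv uv]]]|no] := boolP [exists u, exists v,
    [&& ~~ adjacent x u, adjacent x v & darc u v]]; last first.
  have bad (u v : D) : adjacent x u = false -> adjacent x v -> ~~ darc u v.
    move=> xu xv; apply: contra no => uv.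
    by apply/existsP; exists u; apply/existsP; exists v; rewrite xu xv.
  case: nc; exists (adjacent x) => u v; rewrite /color_ok.
  have := cut x u v; case xu: (adjacent x u); case xv: (adjacent x v) => //=.
  + by move=> /negbT; rewrite negb_or => /andP[].
  + by rewrite /adjacent => /orP[//|vu]; have := bad v u xv xu; rewrite vu.
  + by move=> _; apply: bad.
  + by move=> /negbT; rewrite negb_or => /andP[].
have qvy : adjacent x v = adjacent x y by rewrite xv /adjacent yx orbT.
(* The second alternative would contain a digon, which has been excluded. *)
have [[p1 [p2 [p3 [p12 p21 p23 p32 p13]]]]|[yu uy _ _]] :=
    opposite_arcs (cut x) yx (asym _ _ yx) uv (asym _ _ uv) qvy.
  exact: walk p12 p23.
by have := asym _ _ yu; rewrite uy.
Qed.

Lemma M5_obstructions : minimal_obstruction M5 D <->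
  (digraph_iso D asymmetric_arc \/ digraph_iso D (biorientation K3) \/
   digraph_iso D (biorientation K1_plus_K2)).
Proof.
have K3E := rel_iso_eqr (@darc D) K3_iso.
have K12E := rel_iso_eqr (@darc D) K1_plus_K2_iso.
split=> [Dmin|]; last first.
  case=> [DH|[/K3E DH|/K12E DH]].
  - by apply: (minimal_of_arcs DH).
  - by apply: (minimal_of_test DH).
  - by apply: (minimal_of_test DH).
have [[x [y [xy yx]]]|adjE] := asymmetricP D.
  by left; apply: (minimal_asymmetric_arc Dmin _ xy yx).
right; have /minimal_obstructionP[nc _] := Dmin.
have [[a [x [y [z [t_uniq xy xz yz]]]]]|cut] := odd_triple_or_cut D.
  case: a xy xz => xy xz; [left; apply/K3E|right; apply/K12E];
    apply: (minimal_embedding (x := x) Dmin t_uniq) => //=;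
    by rewrite -!adjE !adjacent_irr !(adjacent_sym y) !(adjacent_sym z) xy xz yz.
have [x _] := uncolorable_arc nc.
(* Arcs now coincide with adjacency, so the complete bipartite cut meets both entries [One]. *)
case: nc; exists (adjacent x) => u v; rewrite -adjE (cut x u v) /color_ok.
by case: (adjacent x u); case: (adjacent x v).
Qed.

(** Only an arcless digraph admits a partition here, so the two ends of any arc already exhaust a
    minimal obstruction. *)
Lemma M6_obstructions : minimal_obstruction M6 D <->
  (digraph_iso D asymmetric_arc \/ digraph_iso D digon).
Proof.
split=> [Dmin|]; last by case=> DH; apply: (minimal_of_arcs DH).
have /minimal_obstructionP[nc _] := Dmin.
have [x [y xy]] := uncolorable_arc nc.
have [yx|yx] := boolP (darc y x); [right|left].
  exact: minimal_digon Dmin _ xy yx.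
exact: minimal_asymmetric_arc Dmin _ xy yx.
Qed.

End Classification.

(** * Finiteness *)

(** Masking the diagonal lets every Boolean function code a digraph. *)
Definition coded_digraph (n : nat) (g : {ffun 'I_n * 'I_n -> bool}) : digraph.
Proof.
by exists 'I_n (fun u v => (u != v) && g (u, v)) => u; rewrite eqxx.
Defined.

(** Codes of digraphs with at most [n] vertices form a finite type, whose enumeration serves as the
    list. *)
Lemma finitely_many_bounded (M : 'M[entry]_2) (n : nat) :
  (forall D : digraph, minimal_obstruction M D -> #|D| <= n) ->
  finitely_many_minimal_obstructions M.
Proof.
move=> small; pose T := {m : 'I_n.+1 & {ffun 'I_m * 'I_m -> bool}}.
exists #|{: T}|, (fun k => coded_digraph (projT2 (enum_val k : T))) => D Dmin.
have Dn : #|D| < n.+1 by apply: small.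
pose g := [ffun p : 'I_#|D| * 'I_#|D| => darc (enum_val p.1) (enum_val p.2)].
pose k : T := existT _ (Ordinal Dn) g.
exists (enum_rank k); rewrite enum_rankK.
exists (enum_rank : D -> 'I_#|D|); first exact: enum_rank_bij.
move=> u v; rewrite /= ffunE /= !enum_rankK (bij_eq (@enum_rank_bij D)).
by have [->|] := eqVneq u v; rewrite ?darc_irr.
Qed.

Lemma mx2_eq (M : 'M[entry]_2) :
  M = mx2 (M ord0 ord0) (M ord0 ord_max) (M ord_max ord0) (M ord_max ord_max).
Proof.
apply/matrixP => i j; rewrite mxE.
have ord1 (k : 'I_2) : k = if k == ord0 then ord0 else ord_max.
  by apply: val_inj; case: k => [[|[|?]] ?].
by rewrite {1}(ord1 i) {1}(ord1 j); case: (i == ord0); case: (j == ord0).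
Qed.

Lemma small_obstructions (b c : entry) (D : digraph) :
  mx2 Zero b c Zero <> M1 ->
  minimal_obstruction (mx2 Zero b c Zero) D -> #|D| <= 4.
Proof.
have iso4 (T : finType) (r : rel D) (s : rel T) :
  #|T| <= 4 -> rel_iso r s -> #|D| <= 4 by move=> T4 /rel_iso_card->.
have sum4 : #|{: 'I_1 + 'I_2}| <= 4 by rewrite card_sum !card_ord.
have ord4 n : n <= 4 -> #|'I_n| <= 4 by rewrite card_ord.
have D2 : minimal_obstruction M2 D -> #|D| <= 4.
  by case/M2_obstructions => [|[|[|]]]; apply: iso4; apply: ord4.
have D3 : minimal_obstruction M3 D -> #|D| <= 4.
  by case/M3_obstructions => [|[|[|]]]; apply: iso4 => //; apply: ord4.
have D4 : minimal_obstruction M4 D -> #|D| <= 4.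
  by case/M4_obstructions => [|[|[|[|]]]]; apply: iso4; apply: ord4.
have D5 : minimal_obstruction M5 D -> #|D| <= 4.
  by case/M5_obstructions => [|[|]]; apply: iso4 => //; apply: ord4.
have D6 : minimal_obstruction M6 D -> #|D| <= 4.
  by case/M6_obstructions => [|]; apply: iso4; apply: ord4.
(* Of the nine pairs, the double [Star] is excluded, five are [M2] to [M6], and the other three
   arise from these by exchanging the parts. *)
case: b; case: c => // _ Dmin; auto; move/minimal_obstruction_swap: Dmin; auto.
Qed.

Theorem theorem1 :
  (forall M : 'M[entry]_2,
     M ord0 ord0 = Zero -> M ord_max ord_max = Zero -> M <> M1 ->
     finitely_many_minimal_obstructions M) /\
  (forall D : digraph, minimal_obstruction M2 D <->
     (digraph_iso D digon \/
      digraph_iso D directed_path3 \/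
      digraph_iso D transitive_tournament3 \/
      digraph_iso D directed_cycle3)) /\
  (forall D : digraph, minimal_obstruction M3 D <->
     (sgraph_iso (underlying D) K3 \/
      sgraph_iso (underlying D) K1_plus_K2 \/
      digraph_iso D directed_path3 \/
      digraph_iso D mixed_cycle4)) /\
  (forall D : digraph, minimal_obstruction M4 D <->
     (digraph_iso D digon \/
      digraph_iso D transitive_tournament3 \/
      digraph_iso D directed_cycle3 \/
      digraph_iso D arc_plus_isolated \/
      digraph_iso D directed_path3)) /\
  (forall D : digraph, minimal_obstruction M5 D <->
     (digraph_iso D asymmetric_arc \/
      digraph_iso D (biorientation K3) \/
      digraph_iso D (biorientation K1_plus_K2))) /\
  (forall D : digraph, minimal_obstruction M6 D <->
     (digraph_iso D asymmetric_arc \/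
      digraph_iso D digon)).
Proof.
split.
  move=> M M00 M11; rewrite (mx2_eq M) M00 M11 => nM1.
  by apply: (finitely_many_bounded (n := 4)) => D; apply: small_obstructions.
split; first exact: M2_obstructions.
split; first exact: M3_obstructions.
split; first exact: M4_obstructions.
split; first exact: M5_obstructions.
exact: M6_obstructions.
Qed.
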